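(* Let $f=(f_0,f_1):(A,\Gamma)\to(B,\Sigma)$ be a map of Hopf algebroids. Then the induced map $f^*:(\operatorname{Spec}B,\operatorname{Spec}\Sigma)\to(\operatorname{Spec}A,\operatorname{Spec}\Gamma)$ of presheaves of groupoids is an internal equivalence in the flat topology if and only if both of the following hold: (i) the ring map $$\eta_L\otimes f_1\otimes\eta_R: B\otimes_A\Gamma\otimes_AB\to\Sigma$$ is an isomorphism; and (ii) there is a ring map $g:B\otimes_A\Gamma\to C$ such that the composite $g\circ(f_0\otimes\eta_R):A\to C$ exhibits $C$ as a faithfully flat extension of $A$.
   Context: All rings are commutative with unit and of cardinality less than a fixed infinite cardinal $\kappa$; $\mathbf{Rings}$ is the category of such rings and $\mathbf{Aff}$ its opposite. $\operatorname{Spec}A:\mathbf{Rings}\to\mathbf{Set}$ is $(\operatorname{Spec}A)(R)=\mathbf{Rings}(A,R)$. A presheaf of groupoids $(X_0,X_1)$ on $\mathbf{Aff}$ is a functor from $\mathbf{Rings}$ to small groupoids, with object sets $X_0(R)$ and morphism sets $X_1(R)$. Hopf algebroid: a pair $(A,\Gamma)$ of rings with ring maps $\eta_L,\eta_R:A\to\Gamma$ (units), $\epsilon:\Gamma\to A$, $\Delta:\Gamma\to\Gamma\otimes_A\Gamma$ ($A$ acting via $\eta_R$ on the left factor and via $\eta_L$ on the right factor) and $c:\Gamma\to\Gamma$ which make $(\operatorname{Spec}A,\operatorname{Spec}\Gamma)$ a presheaf of groupoids, where $\alpha:\Gamma\to R$ is a morphism from $\alpha\eta_L$ to $\alpha\eta_R$,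 composition is induced by $\Delta$, identities by $\epsilon$ and inverses by $c$. A map of Hopf algebroids $(f_0,f_1):(A,\Gamma)\to(B,\Sigma)$ is a pair of ring maps $f_0:A\to B$, $f_1:\Gamma\to\Sigma$ such that precomposition with $f_0,f_1$ is a map of presheaves of groupoids $f^*:(\operatorname{Spec}B,\operatorname{Spec}\Sigma)\to(\operatorname{Spec}A,\operatorname{Spec}\Gamma)$; in particular $f_1\eta_L=\eta_Lf_0$ and $f_1\eta_R=\eta_Rf_0$. In $B\otimes_A\Gamma\otimes_AB$, $B$ is an $A$-algebra via $f_0$, and $\Gamma$ is a left $A$-module via $\eta_L$ and a right $A$-module via $\eta_R$. The map $\eta_L\otimes f_1\otimes\eta_R$ sends $b\otimes\gamma\otimes b'$ to $\eta_L(b)f_1(\gamma)\eta_R(b')$. The map denoted $f_0\otimes\eta_R:A\to B\otimes_A\Gamma$ is $a\mapsto1\otimes\eta_R(a)$ ($\Gamma$ being a left $A$-module via $\eta_L$ in $B\otimes_A\Gamma$). In the flat topology on $\mathbf{Aff}$, a cover of $R$ is a finite family of ring maps $\{R\to S_i\}$ with each $S_i$ flat over $R$ and $\prod_iS_i$ faithfully flat over $R$. For a map $\Phi:(X_0,X_1)\to(Y_0,Y_1)$ of presheaves of groupoids, its essential image consists of the pairs $(R,y)$, $y\in Y_0(R)$, for which there are $x\in X_0(R)$ and a morphism $\Phi x\to y$ in $Y_1(R)$; its sheaf-theoretic essential image consists of the $(R,y)$ for which there is a cover $\{h_i:R\to S_i\}$ with each $Y_0(h_i)(y)$ in the essential image.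 $\Phi$ is an internal equivalence if each functor $\Phi(R)$ is full and faithful and the sheaf-theoretic essential image of $\Phi$ is all of $Y_0$. *)

(* Defs.v *)
From HB Require Import structures.
From mathcomp Require Import all_boot all_order all_algebra generic_quotient.
From mathcomp Require Import boolp classical_sets functions cardinality.

Set Implicit Arguments.
Unset Strict Implicit.
Unset Printing Implicit Defensive.

Import GRing.Theory.
Local Open Scope ring_scope.
Local Open Scope quotient_scope.

(* Rings are [comPzRingType]s, so that the zero ring is allowed. *)

Section RMorphisms.

Lemma rmorphP (R S : pzSemiRingType) (f g : {rmorphism R -> S}) :
  f =1 g -> f = g.
Proof.
case: f g => [f [[f1] [f2]]] [g [[g1] [g2]]] /= /funext efg.
subst g; congr (GRing.RMorphism.Pack (GRing.RMorphism.Class _ _)).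
  by congr (GRing.isNmodMorphism.Axioms_ _ _); exact: Prop_irrelevance.
by congr (GRing.isMonoidMorphism.Axioms_ _ _); exact: Prop_irrelevance.
Qed.

Definition rid (R : pzSemiRingType) : {rmorphism R -> R} :=
  [the {rmorphism R -> R} of idfun].

Definition rcomp (R S T : pzSemiRingType) (g : {rmorphism S -> T})
    (f : {rmorphism R -> S}) : {rmorphism R -> T} :=
  [the {rmorphism R -> T} of g \o f].

Lemma rcompA (R S T U : pzSemiRingType) (h : {rmorphism T -> U})
    (g : {rmorphism S -> T}) (f : {rmorphism R -> S}) :
  rcomp h (rcomp g f) = rcomp (rcomp h g) f.
Proof. exact: rmorphP. Qed.

End RMorphisms.

Section Tensor.
Variables (R : comPzRingType) (M N : lmodType R).

(* A formal sum of symbols m (x) n is a sequence of pairs.  Opposites need not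
   be adjoined: (- m, n) is an opposite of (m, n) modulo [tens_rel]. *)
Inductive tens_rel : seq (M * N) -> seq (M * N) -> Prop :=
| tens_refl s : tens_rel s s
| tens_sym s t : tens_rel s t -> tens_rel t s
| tens_trans s t u : tens_rel s t -> tens_rel t u -> tens_rel s u
| tens_cat s s' t t' :
    tens_rel s s' -> tens_rel t t' -> tens_rel (s ++ t) (s' ++ t')
| tens_catC s t : tens_rel (s ++ t) (t ++ s)
| tens_0l n : tens_rel [:: (0, n)] [::]
| tens_Dl m m' n : tens_rel [:: (m + m', n)] [:: (m, n); (m', n)]
| tens_Dr m n n' : tens_rel [:: (m, n + n')] [:: (m, n); (m, n')]
| tens_Zlr a m n : tens_rel [:: (a *: m, n)] [:: (m, a *: n)].

Definition tens_relb : rel (seq (M * N)) := fun s t => `[< tens_rel s t >].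

Lemma tens_relb_refl : reflexive tens_relb.
Proof. by move=> s; apply/asboolP; exact: tens_refl. Qed.

Lemma tens_relb_sym : symmetric tens_relb.
Proof. by move=> s t; apply/asboolP/asboolP; exact: tens_sym. Qed.

Lemma tens_relb_trans : transitive tens_relb.
Proof.
by move=> t s u /asboolP st /asboolP tu; apply/asboolP; exact: tens_trans tu.
Qed.

Definition tens_equiv : equiv_rel (seq (M * N)) :=
  EquivRel tens_relb tens_relb_refl tens_relb_sym tens_relb_trans.

Definition tens : Type := {eq_quot tens_equiv}.

HB.instance Definition _ := Choice.on tens.
HB.instance Definition _ := EqQuotient.on tens.

Lemma tens_eqP s t : tens_rel s t <-> \pi_tens s = \pi_tens t.
Proof.
split=> [st|e]; first by apply/(eqmodP tens_equiv)/asboolP.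
by have /asboolP := introT (eqmodP tens_equiv s t) e.
Qed.

Lemma tens_surj (x : tens) : exists s, x = \pi_tens s.
Proof. by exists (repr x); rewrite reprK. Qed.

Lemma tens_reprP s : tens_rel (repr (\pi_tens s)) s.
Proof. by apply/tens_eqP; rewrite reprK. Qed.

Definition pure (m : M) (n : N) : tens := \pi_tens [:: (m, n)].
Definition tens_zero : tens := \pi_tens [::].
Definition tens_add (x y : tens) : tens := \pi_tens (repr x ++ repr y).

Lemma tens_addE s t :
  tens_add (\pi_tens s) (\pi_tens t) = \pi_tens (s ++ t).
Proof. by apply/tens_eqP; apply: tens_cat; exact: tens_reprP. Qed.

Lemma tens_addA : associative tens_add.
Proof.
move=> x y z; case: (tens_surj x) (tens_surj y) (tens_surj z).
move=> s -> [t ->] [u ->].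
by rewrite (tens_addE t u) (tens_addE s t) !tens_addE catA.
Qed.

Lemma tens_addC : commutative tens_add.
Proof. by move=> x y; apply/tens_eqP; exact: tens_catC. Qed.

Lemma tens_add0 : left_id tens_zero tens_add.
Proof. by move=> x; case: (tens_surj x) => s ->; exact: (tens_addE [::]). Qed.

HB.instance Definition _ :=
  GRing.isNmodule.Build tens tens_addA tens_addC tens_add0.

Lemma pureDl m m' n : pure (m + m') n = pure m n + pure m' n.
Proof.
by rewrite [RHS]tens_addE; apply/tens_eqP; exact: tens_Dl.
Qed.

Lemma pureDr m n n' : pure m (n + n') = pure m n + pure m n'.
Proof.
by rewrite [RHS]tens_addE; apply/tens_eqP; exact: tens_Dr.
Qed.

Lemma pureZlr a m n : pure (a *: m) n = pure m (a *: n).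
Proof. by apply/tens_eqP; exact: tens_Zlr. Qed.

Lemma pure0l n : pure 0 n = 0.
Proof. by apply/tens_eqP; exact: tens_0l. Qed.

Lemma pi_tensE s : \pi_tens s = \sum_(p <- s) pure p.1 p.2.
Proof.
elim: s => [|[m n] s IHs]; first by rewrite big_nil.
by rewrite big_cons -IHs [RHS]tens_addE.
Qed.

Lemma tens_ind (P : tens -> Prop) :
    P 0 -> (forall m n, P (pure m n)) ->
    (forall x y, P x -> P y -> P (x + y)) ->
  forall x, P x.
Proof.
move=> P0 Pp PD x; case: (tens_surj x) => s ->; rewrite pi_tensE.
by elim/big_ind: _ => // p _; exact: Pp.
Qed.

Record balanced (Z : nmodType) (phi : M -> N -> Z) : Prop := Balanced {
  bal0l : forall n, phi 0 n = 0;
  balDl : forall m m' n, phi (m + m') n = phi m n + phi m' n;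
  balDr : forall m n n', phi m (n + n') = phi m n + phi m n';
  balZ : forall a m n, phi (a *: m) n = phi m (a *: n) }.

(* The additive map m (x) n |-> phi m n; meaningful only if phi is balanced. *)
Definition tens_elim (Z : nmodType) (phi : M -> N -> Z) (x : tens) : Z :=
  \sum_(p <- repr x) phi p.1 p.2.

Section Elim.
Variables (Z : nmodType) (phi : M -> N -> Z).
Hypothesis bal_phi : balanced phi.

Lemma tens_elim_rel s t : tens_rel s t ->
  \sum_(p <- s) phi p.1 p.2 = \sum_(p <- t) phi p.1 p.2.
Proof.
elim=> {s t} [//|s t _ -> //|s t u _ -> _ -> //||s t|n|m m' n|m n n'|a m n].
- by move=> s s' t t' _ es _ et; rewrite !big_cat /= es et.
- by rewrite !big_cat /= addrC.
- by rewrite big_seq1 big_nil /= (bal0l bal_phi).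
- by rewrite !big_cons !big_nil /= !addr0 (balDl bal_phi).
- by rewrite !big_cons !big_nil /= !addr0 (balDr bal_phi).
- by rewrite !big_seq1 /= (balZ bal_phi).
Qed.

Lemma tens_elim_pi s :
  tens_elim phi (\pi_tens s) = \sum_(p <- s) phi p.1 p.2.
Proof. exact/tens_elim_rel/tens_reprP. Qed.

Lemma tens_elim_pure m n : tens_elim phi (pure m n) = phi m n.
Proof. by rewrite tens_elim_pi big_seq1. Qed.

Lemma tens_elim0 : tens_elim phi 0 = 0.
Proof. by rewrite tens_elim_pi big_nil. Qed.

Lemma tens_elimD x y :
  tens_elim phi (x + y) = tens_elim phi x + tens_elim phi y.
Proof. by rewrite tens_elim_pi big_cat. Qed.

End Elim.

Lemma balanced_oppl : balanced (fun m n => pure (- m) n).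
Proof.
split=> [n|m m' n|m n n'|a m n]; rewrite ?oppr0 ?pure0l ?opprD ?pureDl //.
  exact: pureDr.
by rewrite -scalerN pureZlr.
Qed.

Definition tens_opp : tens -> tens := tens_elim (fun m n => pure (- m) n).

Lemma tens_addN : left_inverse 0 tens_opp +%R.
Proof.
elim/tens_ind=> [|m n|x y ex ey]; rewrite /tens_opp.
- by rewrite (tens_elim0 balanced_oppl) addr0.
- by rewrite (tens_elim_pure balanced_oppl) -pureDl addNr pure0l.
by rewrite (tens_elimD balanced_oppl) addrACA [X in X + _]ex [X in _ + X]ey addr0.
Qed.

HB.instance Definition _ := GRing.Nmodule_isZmodule.Build tens tens_addN.

Lemma balanced_scale a : balanced (fun m n => pure (a *: m) n).
Proof.
split=> [n|m m' n|m n n'|b m n]; rewrite ?scaler0 ?pure0l ?scalerDr ?pureDl //.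
  exact: pureDr.
by rewrite scalerA mulrC -scalerA pureZlr.
Qed.

Definition tens_scale (a : R) : tens -> tens :=
  tens_elim (fun m n => pure (a *: m) n).

Lemma tens_scale_pure a m n : tens_scale a (pure m n) = pure (a *: m) n.
Proof. exact: (tens_elim_pure (balanced_scale a)). Qed.

Lemma tens_scaleDr : right_distributive tens_scale +%R.
Proof. by move=> a x y; exact: (tens_elimD (balanced_scale a)). Qed.

Lemma tens_scale0r a : tens_scale a 0 = 0.
Proof. exact: (tens_elim0 (balanced_scale a)). Qed.

Lemma tens_scaleA a b x : tens_scale a (tens_scale b x) = tens_scale (a * b) x.
Proof.
elim/tens_ind: x => [|m n|x y ex ey].
- by rewrite !tens_scale0r.
- by rewrite !tens_scale_pure scalerA.
by rewrite !tens_scaleDr ex ey.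
Qed.

Lemma tens_scale1 : left_id 1 tens_scale.
Proof.
elim/tens_ind=> [|m n|x y ex ey].
- exact: tens_scale0r.
- by rewrite tens_scale_pure scale1r.
by rewrite tens_scaleDr ex ey.
Qed.

Lemma tens_scaleDl x : {morph tens_scale^~ x : a b / a + b}.
Proof.
move=> a b /=; elim/tens_ind: x => [|m n|x y ex ey].
- by rewrite !tens_scale0r addr0.
- by rewrite !tens_scale_pure scalerDl pureDl.
by rewrite !tens_scaleDr ex ey addrACA.
Qed.

HB.instance Definition _ := GRing.Zmodule_isLmodule.Build R tens
  tens_scaleA tens_scale1 tens_scaleDr tens_scaleDl.

Lemma scale_pure a m n : a *: pure m n = pure (a *: m) n.
Proof. exact: tens_scale_pure. Qed.

End Tensor.

Section TensorMap.
Variables (R : comPzRingType) (M N N' : lmodType R) (u : {linear N -> N'}).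

(* M (x) u : M (x) N -> M (x) N' *)
Definition tens_mapr : tens M N -> tens M N' :=
  tens_elim (fun m n => pure m (u n)).

Lemma balanced_mapr : balanced (fun (m : M) n => pure m (u n)).
Proof.
split=> [n|m m' n|m n n'|a m n]; first exact: pure0l.
- exact: pureDl.
- by rewrite linearD pureDr.
by rewrite linearZ pureZlr.
Qed.

Lemma tens_mapr_pure m n : tens_mapr (pure m n) = pure m (u n).
Proof. exact: (tens_elim_pure balanced_mapr). Qed.

Lemma tens_mapr_is_linear : linear tens_mapr.
Proof.
have D := tens_elimD balanced_mapr.
move=> a x y; rewrite /tens_mapr D; congr (_ + _).
elim/tens_ind: x => [|m n|x x' ex ex'].
- by rewrite scaler0 (tens_elim0 balanced_mapr) scaler0.
- by rewrite [tens_elim _ (pure m n)]tens_mapr_pure !scale_pure [LHS]tens_mapr_pure.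
by rewrite scalerDr !D ex ex' scalerDr.
Qed.

HB.instance Definition _ :=
  GRing.isLinear.Build R (tens M N) (tens M N') _ tens_mapr tens_mapr_is_linear.

End TensorMap.

Arguments tens_mapr {R} M {N N'} u _.

Section RestrictScalars.
Variables (A B : comPzRingType) (f : {rmorphism A -> B}).

(* B as an A-module via f *)
Definition restrict of {rmorphism A -> B} : Type := B.

HB.instance Definition _ := GRing.ComPzRing.copy (restrict f) B.

Definition restrict_scale (a : A) (b : restrict f) : restrict f := f a * b.

Lemma restrict_scaleA a b x :
  restrict_scale a (restrict_scale b x) = restrict_scale (a * b) x.
Proof. by rewrite /restrict_scale rmorphM mulrA. Qed.

Lemma restrict_scale1 : left_id 1 restrict_scale.
Proof. by move=> x; rewrite /restrict_scale rmorph1 mul1r. Qed.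

Lemma restrict_scaleDr : right_distributive restrict_scale +%R.
Proof. by move=> a x y; rewrite /restrict_scale mulrDr. Qed.

Lemma restrict_scaleDl x : {morph restrict_scale^~ x : a b / a + b}.
Proof. by move=> a b; rewrite /restrict_scale rmorphD mulrDl. Qed.

HB.instance Definition _ := GRing.Zmodule_isLmodule.Build A (restrict f)
  restrict_scaleA restrict_scale1 restrict_scaleDr restrict_scaleDl.

End RestrictScalars.

Section TensorRing.
Variables (A B C : comPzRingType).
Variables (f : {rmorphism A -> B}) (g : {rmorphism A -> C}).

(* B (x)_A C, where A acts on B via f and on C via g *)
Definition tensr : Type := tens (restrict f) (restrict g).

HB.instance Definition _ := GRing.Lmodule.on tensr.

Definition tpure (b : B) (c : C) : tensr :=
  pure (b : restrict f) (c : restrict g).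

Lemma tpureDl b b' c : tpure (b + b') c = tpure b c + tpure b' c.
Proof. exact: pureDl. Qed.

Lemma tpureDr b c c' : tpure b (c + c') = tpure b c + tpure b c'.
Proof. exact: pureDr. Qed.

Lemma tpure0l c : tpure 0 c = 0.
Proof. exact: pure0l. Qed.

Lemma tpureZlr a b c : tpure (f a * b) c = tpure b (g a * c).
Proof. exact: pureZlr. Qed.

Lemma tensr_ind (P : tensr -> Prop) :
    P 0 -> (forall b c, P (tpure b c)) ->
    (forall x y, P x -> P y -> P (x + y)) ->
  forall x, P x.
Proof. exact: (@tens_ind A (restrict f) (restrict g) P). Qed.

Definition tensr_balanced (Z : nmodType) (phi : B -> C -> Z) : Prop :=
  @balanced A (restrict f) (restrict g) Z phi.

Definition tensr_elim (Z : nmodType) (phi : B -> C -> Z) (x : tensr) : Z :=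
  @tens_elim A (restrict f) (restrict g) Z phi x.

Lemma balanced_mulp b c :
  tensr_balanced (fun b' c' => tpure (b * b') (c * c')).
Proof.
split=> [c'|b1 b2 c'|b' c1 c2|a b' c'].
- by rewrite mulr0 tpure0l.
- by rewrite mulrDr tpureDl.
- by rewrite mulrDr tpureDr.
by rewrite [b * _]mulrCA tpureZlr mulrCA.
Qed.

Definition tensr_mulp b c : tensr -> tensr :=
  tensr_elim (fun b' c' => tpure (b * b') (c * c')).

Lemma tensr_mulp_pure b c b' c' :
  tensr_mulp b c (tpure b' c') = tpure (b * b') (c * c').
Proof. exact: (tens_elim_pure (balanced_mulp b c)). Qed.

Lemma tensr_mulpD b c x y :
  tensr_mulp b c (x + y) = tensr_mulp b c x + tensr_mulp b c y.
Proof. exact: (tens_elimD (balanced_mulp b c)). Qed.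

Lemma tensr_mulp0 b c : tensr_mulp b c 0 = 0.
Proof. exact: (tens_elim0 (balanced_mulp b c)). Qed.

Lemma balanced_mul y : tensr_balanced (fun b c => tensr_mulp b c y).
Proof.
split=> [c|b b' c|b c c'|a b c].
- elim/tensr_ind: y => [|b0 c0|x y ex ey]; first by rewrite tensr_mulp0.
    by rewrite tensr_mulp_pure mul0r tpure0l.
  by rewrite tensr_mulpD ex ey addr0.
- elim/tensr_ind: y => [|b0 c0|x y ex ey]; first by rewrite !tensr_mulp0 addr0.
    by rewrite !tensr_mulp_pure mulrDl tpureDl.
  by rewrite !tensr_mulpD ex ey addrACA.
- elim/tensr_ind: y => [|b0 c0|x y ex ey]; first by rewrite !tensr_mulp0 addr0.
    by rewrite !tensr_mulp_pure mulrDl tpureDr.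
  by rewrite !tensr_mulpD ex ey addrACA.
elim/tensr_ind: y => [|b0 c0|x y ex ey]; first by rewrite !tensr_mulp0.
  by rewrite !tensr_mulp_pure -!mulrA tpureZlr.
by rewrite !tensr_mulpD ex ey.
Qed.

(* (b (x) c) * (b' (x) c') = (b * b') (x) (c * c') *)
Definition tensr_mul (x y : tensr) : tensr :=
  tensr_elim (fun b c => tensr_mulp b c y) x.

Lemma tensr_mul_purel b c y : tensr_mul (tpure b c) y = tensr_mulp b c y.
Proof. exact: (tens_elim_pure (balanced_mul y)). Qed.

Lemma tensr_mul_pure b c b' c' :
  tensr_mul (tpure b c) (tpure b' c') = tpure (b * b') (c * c').
Proof. by rewrite tensr_mul_purel tensr_mulp_pure. Qed.

Lemma tensr_mulDl : left_distributive tensr_mul +%R.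
Proof. by move=> x y z; exact: (tens_elimD (balanced_mul z)). Qed.

Lemma tensr_mul0l x : tensr_mul 0 x = 0.
Proof. exact: (tens_elim0 (balanced_mul x)). Qed.

Lemma tensr_mul0r x : tensr_mul x 0 = 0.
Proof.
elim/tensr_ind: x => [|b c|x y ex ey]; first exact: tensr_mul0l.
  by rewrite tensr_mul_purel tensr_mulp0.
by rewrite tensr_mulDl ex ey addr0.
Qed.

Lemma tensr_mulDr : right_distributive tensr_mul +%R.
Proof.
move=> x y z; elim/tensr_ind: x => [|b c|x x' ex ex'].
- by rewrite !tensr_mul0l addr0.
- by rewrite !tensr_mul_purel tensr_mulpD.
by rewrite !tensr_mulDl ex ex' addrACA.
Qed.

Lemma tensr_mulC : commutative tensr_mul.
Proof.
move=> x y; elim/tensr_ind: x => [|b c|x x' ex ex'].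
- by rewrite tensr_mul0l tensr_mul0r.
- elim/tensr_ind: y => [|b' c'|y y' ey ey'].
  + by rewrite tensr_mul0l tensr_mul0r.
  + by rewrite !tensr_mul_pure mulrC [c * _]mulrC.
  + by rewrite tensr_mulDl tensr_mulDr ey ey'.
by rewrite tensr_mulDl tensr_mulDr ex ex'.
Qed.

Lemma tensr_mulA : associative tensr_mul.
Proof.
move=> x y z; elim/tensr_ind: x => [|b c|x x' ex ex'].
- by rewrite !tensr_mul0l.
- elim/tensr_ind: y => [|b' c'|y y' ey ey'].
  + by rewrite tensr_mul0l tensr_mul0r tensr_mul0l.
  + elim/tensr_ind: z => [|b'' c''|z z' ez ez'].
    * by rewrite !tensr_mul0r.
    * by rewrite !tensr_mul_pure !mulrA.
    * by rewrite !tensr_mulDr ez ez'.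
  + by rewrite tensr_mulDl !tensr_mulDr tensr_mulDl ey ey'.
by rewrite !tensr_mulDl ex ex'.
Qed.

Lemma tensr_mul1 : left_id (tpure 1 1) tensr_mul.
Proof.
elim/tensr_ind=> [|b c|x y ex ey]; first exact: tensr_mul0r.
  by rewrite tensr_mul_pure !mul1r.
by rewrite tensr_mulDr ex ey.
Qed.

HB.instance Definition _ := GRing.Zmodule_isComPzRing.Build tensr
  tensr_mulA tensr_mulC tensr_mul1 tensr_mulDl.

Lemma tpureM b c b' c' : tpure b c * tpure b' c' = tpure (b * b') (c * c').
Proof. exact: tensr_mul_pure. Qed.

Lemma tpure11 : tpure 1 1 = 1.
Proof. by []. Qed.

Lemma tpure0r b : tpure b 0 = 0.
Proof. by apply: (addrI (tpure b 0)); rewrite -tpureDr !addr0. Qed.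

Definition tinl_fun (b : B) : tensr := tpure b 1.
Definition tinr_fun (c : C) : tensr := tpure 1 c.

Lemma tinl_nmod : nmod_morphism tinl_fun.
Proof. by split=> [|b b']; [exact: tpure0l | exact: tpureDl]. Qed.

Lemma tinl_monoid : monoid_morphism tinl_fun.
Proof. by split=> // b b'; rewrite /tinl_fun tpureM mulr1. Qed.

Lemma tinr_nmod : nmod_morphism tinr_fun.
Proof. by split=> [|c c']; [exact: tpure0r | exact: tpureDr]. Qed.

Lemma tinr_monoid : monoid_morphism tinr_fun.
Proof. by split=> // c c'; rewrite /tinr_fun tpureM mulr1. Qed.

HB.instance Definition _ := GRing.isNmodMorphism.Build B tensr tinl_fun tinl_nmod.
HB.instance Definition _ :=
  GRing.isMonoidMorphism.Build B tensr tinl_fun tinl_monoid.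
HB.instance Definition _ := GRing.isNmodMorphism.Build C tensr tinr_fun tinr_nmod.
HB.instance Definition _ :=
  GRing.isMonoidMorphism.Build C tensr tinr_fun tinr_monoid.

Definition tinl : {rmorphism B -> tensr} := [the {rmorphism B -> tensr} of tinl_fun].
Definition tinr : {rmorphism C -> tensr} := [the {rmorphism C -> tensr} of tinr_fun].

Section Lift.
Variables (D : comPzRingType) (u : {rmorphism B -> D}) (v : {rmorphism C -> D}).
Hypothesis uv : rcomp u f = rcomp v g.

(* b (x) c |-> u b * v c *)
Definition tensr_lift_fun of rcomp u f = rcomp v g : tensr -> D :=
  tensr_elim (fun b c => u b * v c).

Lemma balanced_lift : tensr_balanced (fun b c => u b * v c).
Proof.
split=> [c|b b' c|b c c'|a b c].
- by rewrite rmorph0 mul0r.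
- by rewrite rmorphD mulrDl.
- by rewrite rmorphD mulrDr.
have e : u (f a) = v (g a).
  by have := congr1 (fun h => GRing.RMorphism.sort h a) uv.
rewrite -[a *: b]/(f a * b) -[a *: c]/(g a * c).
by rewrite !rmorphM e -mulrA mulrCA.
Qed.

Lemma tensr_lift_pure b c : tensr_lift_fun uv (tpure b c) = u b * v c.
Proof. exact: (tens_elim_pure balanced_lift). Qed.

Lemma tensr_lift_nmod : nmod_morphism (tensr_lift_fun uv).
Proof.
split; first exact: (tens_elim0 balanced_lift).
by move=> x y; exact: (tens_elimD balanced_lift).
Qed.

HB.instance Definition _ :=
  GRing.isNmodMorphism.Build tensr D (tensr_lift_fun uv) tensr_lift_nmod.

Lemma tensr_lift_monoid : monoid_morphism (tensr_lift_fun uv).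
Proof.
have [F0 FD] := tensr_lift_nmod.
split; first by rewrite -tpure11 tensr_lift_pure !rmorph1 mulr1.
move=> x y; elim/tensr_ind: x => [|b c|x x' ex ex'].
- by rewrite mul0r F0 mul0r.
- elim/tensr_ind: y => [|b' c'|y y' ey ey'].
  + by rewrite mulr0 F0 mulr0.
  + by rewrite tpureM !tensr_lift_pure !rmorphM mulrACA.
  + by rewrite mulrDr !FD mulrDr ey ey'.
by rewrite mulrDl !FD mulrDl ex ex'.
Qed.

HB.instance Definition _ :=
  GRing.isMonoidMorphism.Build tensr D (tensr_lift_fun uv) tensr_lift_monoid.

Definition tensr_lift : {rmorphism tensr -> D} :=
  [the {rmorphism tensr -> D} of tensr_lift_fun uv].

Lemma tensr_liftE b c : tensr_lift (tpure b c) = u b * v c.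
Proof. exact: tensr_lift_pure. Qed.

End Lift.

Lemma tensr_eq (D : comPzRingType) (h k : {rmorphism tensr -> D}) :
  (forall b c, h (tpure b c) = k (tpure b c)) -> h = k.
Proof.
move=> hk; apply: rmorphP; elim/tensr_ind=> [|b c|x y ex ey]; first by rewrite !rmorph0.
  exact: hk.
by rewrite !rmorphD ex ey.
Qed.

Lemma tensr_lift_comp (D E : comPzRingType) (u : {rmorphism B -> D})
    (v : {rmorphism C -> D}) (w : {rmorphism D -> E})
    (e : rcomp u f = rcomp v g) (e' : rcomp (rcomp w u) f = rcomp (rcomp w v) g) :
  rcomp w (tensr_lift e) = tensr_lift e'.
Proof.
by apply: tensr_eq => b c; rewrite /= !tensr_lift_pure rmorphM.
Qed.

End TensorRing.

(* A complex N1 -> N2 -> N3 of modules is tested for exactness at N2; flatness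
   (resp. faithful flatness) means that M (x) - preserves (resp. preserves and
   reflects) exactness. *)
Definition exact_at (N1 N2 N3 : zmodType) (u : N1 -> N2) (v : N2 -> N3) : Prop :=
  forall y : N2, v y = 0 <-> exists x : N1, u x = y.

Definition flat_module (R : comPzRingType) (M : lmodType R) : Prop :=
  forall (N1 N2 N3 : lmodType R) (u : {linear N1 -> N2}) (v : {linear N2 -> N3}),
    exact_at u v -> exact_at (tens_mapr M u) (tens_mapr M v).

Definition faithfully_flat_module (R : comPzRingType) (M : lmodType R) : Prop :=
  forall (N1 N2 N3 : lmodType R) (u : {linear N1 -> N2}) (v : {linear N2 -> N3}),
    exact_at u v <-> exact_at (tens_mapr M u) (tens_mapr M v).

Definition flat (R S : comPzRingType) (h : {rmorphism R -> S}) : Prop :=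
  flat_module (restrict h).

Definition faithfully_flat (R S : comPzRingType) (h : {rmorphism R -> S}) : Prop :=
  faithfully_flat_module (restrict h).

Section ProductRing.
Variables (n : nat) (S : 'I_n -> comPzRingType).

Definition prodr : Type := {dffun forall i, S i}.

HB.instance Definition _ := Choice.on prodr.

Definition prodr_mk (F : forall i, S i) : prodr := finfun F.
Definition prodr_proj (i : 'I_n) (x : prodr) : S i := x i.

Lemma prodr_mkE F i : prodr_proj i (prodr_mk F) = F i.
Proof. exact: ffunE. Qed.

Lemma prodrP (x y : prodr) : (forall i, prodr_proj i x = prodr_proj i y) -> x = y.
Proof. by move=> exy; apply/ffunP. Qed.

Definition prodr_zero : prodr := prodr_mk (fun=> 0).
Definition prodr_opp (x : prodr) : prodr := prodr_mk (fun i => - prodr_proj i x).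
Definition prodr_add (x y : prodr) : prodr :=
  prodr_mk (fun i => prodr_proj i x + prodr_proj i y).
Definition prodr_one : prodr := prodr_mk (fun=> 1).
Definition prodr_mul (x y : prodr) : prodr :=
  prodr_mk (fun i => prodr_proj i x * prodr_proj i y).

Lemma prodr_addA : associative prodr_add.
Proof. by move=> x y z; apply: prodrP => i; rewrite !prodr_mkE addrA. Qed.
Lemma prodr_addC : commutative prodr_add.
Proof. by move=> x y; apply: prodrP => i; rewrite !prodr_mkE addrC. Qed.
Lemma prodr_add0 : left_id prodr_zero prodr_add.
Proof. by move=> x; apply: prodrP => i; rewrite !prodr_mkE add0r. Qed.
Lemma prodr_addN : left_inverse prodr_zero prodr_opp prodr_add.
Proof. by move=> x; apply: prodrP => i; rewrite !prodr_mkE addNr. Qed.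

HB.instance Definition _ := GRing.isZmodule.Build prodr
  prodr_addA prodr_addC prodr_add0 prodr_addN.

Lemma prodr_mulA : associative prodr_mul.
Proof. by move=> x y z; apply: prodrP => i; rewrite !prodr_mkE mulrA. Qed.
Lemma prodr_mulC : commutative prodr_mul.
Proof. by move=> x y; apply: prodrP => i; rewrite !prodr_mkE mulrC. Qed.
Lemma prodr_mul1 : left_id prodr_one prodr_mul.
Proof. by move=> x; apply: prodrP => i; rewrite !prodr_mkE mul1r. Qed.
Lemma prodr_mulDl : left_distributive prodr_mul +%R.
Proof. by move=> x y z; apply: prodrP => i; rewrite !prodr_mkE mulrDl. Qed.

HB.instance Definition _ := GRing.Zmodule_isComPzRing.Build prodr
  prodr_mulA prodr_mulC prodr_mul1 prodr_mulDl.

Variables (R : comPzRingType) (h : forall i, {rmorphism R -> S i}).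

Definition prodr_tuple_fun : R -> prodr :=
  fun r => prodr_mk (fun i => h i r).

Lemma prodr_tuple_nmod : nmod_morphism prodr_tuple_fun.
Proof.
by split=> [|a b]; apply: prodrP => i; rewrite !prodr_mkE ?rmorph0 ?rmorphD.
Qed.

Lemma prodr_tuple_monoid : monoid_morphism prodr_tuple_fun.
Proof.
by split=> [|a b]; apply: prodrP => i; rewrite !prodr_mkE ?rmorph1 ?rmorphM.
Qed.

HB.instance Definition _ :=
  GRing.isNmodMorphism.Build R prodr prodr_tuple_fun prodr_tuple_nmod.
HB.instance Definition _ :=
  GRing.isMonoidMorphism.Build R prodr prodr_tuple_fun prodr_tuple_monoid.

(* the map R -> \prod_i S i with components h i *)
Definition prodr_tuple : {rmorphism R -> prodr} :=
  [the {rmorphism R -> prodr} of prodr_tuple_fun].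

End ProductRing.

(* The data of a groupoid with one set of objects and one set of morphisms;
   [gcomp a b _] is "first a, then b". *)
Record groupoid_data := GroupoidData {
  obj : Type;
  mor : Type;
  src : mor -> obj;
  tgt : mor -> obj;
  gid : obj -> mor;
  gcomp : forall a b : mor, tgt a = src b -> mor;
  ginv : mor -> mor }.

Arguments src {_} _.
Arguments tgt {_} _.
Arguments gid {_} _.
Arguments gcomp {_} _ _ _.
Arguments ginv {_} _.

Record is_groupoid (G : groupoid_data) : Prop := IsGroupoid {
  src_id : forall x : obj G, src (gid x) = x;
  tgt_id : forall x : obj G, tgt (gid x) = x;
  src_comp : forall (a b : mor G) (ab : tgt a = src b), src (gcomp a b ab) = src a;
  tgt_comp : forall (a b : mor G) (ab : tgt a = src b), tgt (gcomp a b ab) = tgt b;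
  src_inv : forall a : mor G, src (ginv a) = tgt a;
  tgt_inv : forall a : mor G, tgt (ginv a) = src a;
  comp_idl : forall (a : mor G) (e : tgt (gid (src a)) = src a),
    gcomp (gid (src a)) a e = a;
  comp_idr : forall (a : mor G) (e : tgt a = src (gid (tgt a))),
    gcomp a (gid (tgt a)) e = a;
  comp_assoc : forall (a b c : mor G) (ab : tgt a = src b) (bc : tgt b = src c)
      (ab_c : tgt (gcomp a b ab) = src c) (a_bc : tgt a = src (gcomp b c bc)),
    gcomp (gcomp a b ab) c ab_c = gcomp a (gcomp b c bc) a_bc;
  comp_invr : forall (a : mor G) (e : tgt a = src (ginv a)),
    gcomp a (ginv a) e = gid (src a);
  comp_invl : forall (a : mor G) (e : tgt (ginv a) = src a),
    gcomp (ginv a) a e = gid (tgt a) }.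

Record groupoid := Groupoid {
  groupoid_sort :> groupoid_data;
  groupoidP : is_groupoid groupoid_sort }.

Record is_functor (G H : groupoid_data) (Fo : obj G -> obj H)
    (Fm : mor G -> mor H) : Prop := IsFunctor {
  functor_src : forall a, src (Fm a) = Fo (src a);
  functor_tgt : forall a, tgt (Fm a) = Fo (tgt a);
  functor_id : forall x, Fm (gid x) = gid (Fo x);
  functor_comp : forall a b (e : tgt a = src b) (e' : tgt (Fm a) = src (Fm b)),
    Fm (gcomp a b e) = gcomp (Fm a) (Fm b) e' }.

Record functor (G H : groupoid_data) := Functor {
  fobj : obj G -> obj H;
  fmor : mor G -> mor H;
  functorP : is_functor fobj fmor }.

Definition full (G H : groupoid_data) (F : functor G H) : Prop :=
  forall (x y : obj G) (b : mor H), src b = fobj F x -> tgt b = fobj F y ->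
    exists a : mor G, [/\ src a = x, tgt a = y & fmor F a = b].

Definition faithful (G H : groupoid_data) (F : functor G H) : Prop :=
  forall a a' : mor G, src a = src a' -> tgt a = tgt a' ->
    fmor F a = fmor F a' -> a = a'.

(* The cardinal kappa is represented by a type K of that cardinality; T has
   cardinality < kappa when T injects into K but not conversely. *)
Definition card_lt (T K : Type) : Prop :=
  ([set: T] #<= [set: K])%card /\ ~ ([set: K] #<= [set: T])%card.

Record smallRing (K : Type) := SmallRing {
  smallRing_sort :> comPzRingType;
  smallRingP : card_lt smallRing_sort K }.

Record presheaf (K : Type) := Presheaf {
  psh :> smallRing K -> groupoid;
  psh_map : forall R S : smallRing K, {rmorphism R -> S} -> functor (psh R) (psh S);
  psh_map_id_obj : forall (R : smallRing K) x, fobj (@psh_map R R (rid R)) x = x;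
  psh_map_id_mor : forall (R : smallRing K) a, fmor (@psh_map R R (rid R)) a = a;
  psh_map_comp_obj : forall (R S T : smallRing K) (h : {rmorphism R -> S})
      (k : {rmorphism S -> T}) x,
    fobj (@psh_map R T (rcomp k h)) x = fobj (psh_map k) (fobj (psh_map h) x);
  psh_map_comp_mor : forall (R S T : smallRing K) (h : {rmorphism R -> S})
      (k : {rmorphism S -> T}) a,
    fmor (@psh_map R T (rcomp k h)) a = fmor (psh_map k) (fmor (psh_map h) a) }.

Arguments psh_map {K} p {R S} h.

Record presheaf_map (K : Type) (X Y : presheaf K) := PresheafMap {
  pmap_at :> forall R : smallRing K, functor (X R) (Y R);
  pmap_nat_obj : forall (R S : smallRing K) (h : {rmorphism R -> S}) x,
    fobj (pmap_at S) (fobj (psh_map X h) x) = fobj (psh_map Y h) (fobj (pmap_at R) x);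
  pmap_nat_mor : forall (R S : smallRing K) (h : {rmorphism R -> S}) a,
    fmor (pmap_at S) (fmor (psh_map X h) a) = fmor (psh_map Y h) (fmor (pmap_at R) a) }.

Definition flat_cover (K : Type) (R : smallRing K) (n : nat)
    (S : 'I_n -> smallRing K) (h : forall i, {rmorphism R -> S i}) : Prop :=
  (forall i, flat (h i)) /\ faithfully_flat (prodr_tuple h).

Definition essential_image (K : Type) (X Y : presheaf K) (Phi : presheaf_map X Y)
    (R : smallRing K) (y : obj (Y R)) : Prop :=
  exists (x : obj (X R)) (a : mor (Y R)), src a = fobj (Phi R) x /\ tgt a = y.

Definition sheaf_essential_image (K : Type) (X Y : presheaf K)
    (Phi : presheaf_map X Y) (R : smallRing K) (y : obj (Y R)) : Prop :=
  exists (n : nat) (S : 'I_n -> smallRing K) (h : forall i, {rmorphism R -> S i}),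
    flat_cover h /\ forall i, essential_image Phi (fobj (psh_map Y (h i)) y).

Definition internal_equivalence (K : Type) (X Y : presheaf K)
    (Phi : presheaf_map X Y) : Prop :=
  (forall R : smallRing K, full (Phi R) /\ faithful (Phi R)) /\
  (forall (R : smallRing K) (y : obj (Y R)), sheaf_essential_image Phi y).

(* The unbundled data (A, Gamma) = (hA, hG) of a Hopf algebroid, with counit
   [eps] and inverse [coinv].  In the codomain of [Delta], A acts via etaR on
   the left factor and via etaL on the right one. *)
Record hopf_data (K : Type) := HopfData {
  hA : smallRing K;
  hG : smallRing K;
  etaL : {rmorphism hA -> hG};
  etaR : {rmorphism hA -> hG};
  eps : {rmorphism hG -> hA};
  Delta : {rmorphism hG -> tensr etaR etaL};
  coinv : {rmorphism hG -> hG} }.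

(* A morphism a : Gamma -> R goes from a o etaL to a o etaR; the composite of a
   and b is (a (x) b) o Delta. *)
Definition spec_data (K : Type) (X : hopf_data K) (R : smallRing K) : groupoid_data :=
  @GroupoidData {rmorphism hA X -> R} {rmorphism hG X -> R}
    (fun a => rcomp a (etaL X)) (fun a => rcomp a (etaR X))
    (fun x => rcomp x (eps X))
    (fun a b e => rcomp (tensr_lift e) (Delta X))
    (fun a => rcomp a (coinv X)).

Record hopf_algebroid (K : Type) := HopfAlgebroid {
  hopf_sort :> hopf_data K;
  hopfP : forall R : smallRing K, is_groupoid (spec_data hopf_sort R) }.

Section Spec.
Variables (K : Type) (X : hopf_algebroid K).

Definition spec_groupoid (R : smallRing K) : groupoid := Groupoid (hopfP X R).

Lemma spec_map_functor (R S : smallRing K) (h : {rmorphism R -> S}) :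
  @is_functor (spec_groupoid R) (spec_groupoid S)
    (fun x => rcomp h x) (fun a => rcomp h a).
Proof.
split=> [a|a|x|a b e e']; rewrite /= ?rcompA //.
by rewrite (tensr_lift_comp e e').
Qed.

Definition spec_map (R S : smallRing K) (h : {rmorphism R -> S}) :
    functor (spec_groupoid R) (spec_groupoid S) :=
  Functor (spec_map_functor h).

Definition spec : presheaf K.
Proof.
refine (@Presheaf K spec_groupoid spec_map _ _ _ _).
- by move=> R x; exact: rmorphP.
- by move=> R a; exact: rmorphP.
- by move=> R S T h k x; rewrite /= rcompA.
- by move=> R S T h k a; rewrite /= rcompA.
Defined.

End Spec.

Record hopf_map (K : Type) (X Y : hopf_algebroid K) := HopfMap {
  f0 : {rmorphism hA X -> hA Y};
  f1 : {rmorphism hG X -> hG Y};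
  hopf_mapP : forall R : smallRing K,
    @is_functor (spec Y R) (spec X R) (fun x => rcomp x f0) (fun a => rcomp a f1) }.

Section HopfMap.
Variables (K : Type) (X Y : hopf_algebroid K) (f : hopf_map X Y).

Definition spec_pullback : presheaf_map (spec Y) (spec X).
Proof.
refine (@PresheafMap K (spec Y) (spec X) (fun R => Functor (hopf_mapP f R)) _ _).
- by move=> R S h x; rewrite /= rcompA.
- by move=> R S h a; rewrite /= rcompA.
Defined.

Lemma f1_etaL : rcomp (f1 f) (etaL X) = rcomp (etaL Y) (f0 f).
Proof.
have := functor_src (hopf_mapP f (hG Y)) (rid _); rewrite /= => e.
by rewrite (_ : f1 f = rcomp (rid _) (f1 f)) ?e; exact: rmorphP.
Qed.

Lemma f1_etaR : rcomp (f1 f) (etaR X) = rcomp (etaR Y) (f0 f).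
Proof.
have := functor_tgt (hopf_mapP f (hG Y)) (rid _); rewrite /= => e.
by rewrite (_ : f1 f = rcomp (rid _) (f1 f)) ?e; exact: rmorphP.
Qed.

(* B (x)_A Gamma *)
Definition BG : comPzRingType := tensr (f0 f) (etaL X).

(* a |-> 1 (x) etaR a *)
Definition f0_tens_etaR : {rmorphism hA X -> BG} :=
  rcomp (tinr (f0 f) (etaL X)) (etaR X).

(* B (x)_A Gamma (x)_A B, as (B (x)_A Gamma) (x)_A B *)
Definition BGB : comPzRingType := tensr f0_tens_etaR (f0 f).

Lemma etaL_f1_compat : rcomp (etaL Y) (f0 f) = rcomp (f1 f) (etaL X).
Proof. by rewrite f1_etaL. Qed.

(* b (x) gamma |-> etaL b * f1 gamma *)
Definition etaL_f1 : {rmorphism BG -> hG Y} := tensr_lift etaL_f1_compat.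

Lemma etaL_f1_etaR_compat : rcomp etaL_f1 f0_tens_etaR = rcomp (etaR Y) (f0 f).
Proof.
rewrite -f1_etaR; apply: rmorphP => a /=.
by rewrite tensr_lift_pure rmorph1 mul1r.
Qed.

Definition etaL_f1_etaR : {rmorphism BGB -> hG Y} :=
  tensr_lift etaL_f1_etaR_compat.

Lemma etaL_f1_etaRE b c b' :
  etaL_f1_etaR (tpure f0_tens_etaR (f0 f) (tpure (f0 f) (etaL X) b c) b') =
  etaL Y b * f1 f c * etaR Y b'.
Proof. by rewrite !tensr_liftE. Qed.

End HopfMap.

(* Main.v *)
(* Points of B (x)_A Gamma (x)_A B over R are the triples (x, a, y) with a an
   arrow from x o f0 to y o f0, so f^* is fully faithful iff Sigma and
   B (x)_A Gamma (x)_A B have the same points, which by Yoneda is (i).  A point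
   of B (x)_A Gamma is an arrow a whose source comes from Spec B, and 1 (x) etaR
   picks its target: essential surjectivity at the universal point id of Spec A
   gives (ii), and conversely the cover R -> R (x)_A C trivializes the problem
   for y : A -> R.  All this requires rings of cardinality < kappa to be
   stable under tensor products and finite products, which rests on
   |seq T| <= |T| for T infinite, a consequence of Zorn's lemma. *)

Require Import Defs.
From HB Require Import structures.
From mathcomp Require Import all_boot all_order all_algebra.
From mathcomp Require Import boolp classical_sets functions cardinality.

Set Implicit Arguments.
Unset Strict Implicit.
Unset Printing Implicit Defensive.

Import GRing.Theory.
Local Open Scope ring_scope.
Local Open Scope classical_set_scope.

(** * Cardinality of sequences, products and tensor products *)

Lemma card_leTP (T U : Type) :
  ([set: T] #<= [set: U])%card <-> exists f : T -> U, injective f.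
Proof.
split=> [/card_leP[f]|[f f_inj]].
  pose mk (x : T) : [set: T] := SigSub (mem_set (I : [set: T] x)).
  exists (fun x => val (f (mk x))) => x y /val_inj exy.
  have /(congr1 val) : mk x = mk y by apply: (@inj _ _ setT f); rewrite ?inE.
  by [].
have /injfunPex[g] : exists2 f, set_fun [set: T] [set: U] f & set_inj [set: T] f.
  by exists f => // x y _ _ /f_inj.
exact: inj_card_le g.
Qed.

Lemma surj_inj (T U : Type) (f : T -> U) :
  (forall y, exists x, f x = y) -> exists g : U -> T, injective g.
Proof.
move=> /choice[g fg]; exists g => x y exy.
by rewrite -[x]fg exy fg.
Qed.

Lemma sval_inj (T : Type) (P : T -> Prop) : injective (@sval T P).
Proof. by move=> [x Px] [y Py] /= exy; exact: eq_exist. Qed.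

(* A maximal partial bijection is total on one of the two sides. *)
Lemma inj_total (T U : Type) :
  (exists f : T -> U, injective f) \/ (exists f : U -> T, injective f).
Proof.
(* The equivalence says at once that [G] is single-valued and injective; as it concerns two pairs at
   a time, it passes to unions of chains. *)
pose P (G : set (T * U)) := forall p q, G p -> G q -> (p.1 = q.1 <-> p.2 = q.2).
have [F FP Ftot|G [GP Gmax]] := @Zorn_bigcup _ P.
  move=> p q [G FG Gp] [H FH Hq].
  by have [GH|HG] := Ftot _ _ FG FH;
    [apply: (FP _ FH) => //; exact: GH|apply: (FP _ FG) => //; exact: HG].
have [domG|/existsNP[t Gt]] := pselect (forall t, exists u, G (t, u)).
  by left; have [f Gf] := choice domG; exists f => x y /(GP _ _ (Gf x) (Gf y)).
have [imG|/existsNP[u Gu]] := pselect (forall u, exists t, G (t, u)).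
  by right; have [f Gf] := choice imG; exists f => x y /(GP _ _ (Gf x) (Gf y)).
(* No pair of [G] has [t] or [u] as a component, so adding [(t, u)] gives a strictly larger partial
   bijection. *)
exfalso; apply: (Gmax (G `|` [set (t, u)])).
  split=> [|sub]; first exact: subsetUl.
  by apply: Gt; exists u; apply: sub; right.
have nt p : G p -> p.1 <> t.
  by move=> Gp pt; apply: Gt; exists p.2; rewrite -pt -surjective_pairing.
have nu p : G p -> p.2 <> u.
  by move=> Gp pu; apply: Gu; exists p.1; rewrite -pu -surjective_pairing.
move=> p q [Gp|->] [Gq|->] /=; first exact: GP.
- by split=> [/nt|/nu]; move/(_ Gp).
- by split=> /esym => [/nt|/nu]; move/(_ Gq).
by [].
Qed.

(** * Finite sequences over an infinite type *)

Section SeqCardinal.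
Variable T : choiceType.

Definition seqs_on (X : set T) : set (seq T) := [set s | {in s, forall x, X x}].

(** The approximations to which Zorn's lemma is applied. [coding] is a total function to avoid
    dependent types; only its values on sequences over the domain matter. *)
Record seq_coding := SeqCoding {
  coding_dom : set T;
  coding : seq T -> T;
  coding_in : forall s, seqs_on coding_dom s -> coding_dom (coding s);
  coding_inj : forall s t, seqs_on coding_dom s -> seqs_on coding_dom t ->
    coding s = coding t -> s = t }.

(** Extension of codings. It is only a preorder, since two codings may differ outside a common
    domain. *)
Definition coding_le (c d : seq_coding) : Prop :=
  coding_dom c `<=` coding_dom d /\
  forall s, seqs_on (coding_dom c) s -> coding c s = coding d s.

Lemma seqs_onS (X Y : set T) : X `<=` Y -> seqs_on X `<=` seqs_on Y.
Proof. by move=> XY s sX x /sX /XY. Qed.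

Lemma coding_le_trans c d e : coding_le c d -> coding_le d e -> coding_le c e.
Proof.
move=> [cd cdE] [de deE]; split=> [|s sc]; first exact: subset_trans de.
by rewrite cdE // deE //; exact: seqs_onS sc.
Qed.

(** A finite sequence over the union of the domains already lies over one member of the chain, which
    dictates its code; two sequences lie over a common member, whence injectivity. *)
Lemma coding_chain (A : set seq_coding) : A !=set0 ->
  total_on A coding_le -> exists d, forall c, A c -> coding_le c d.
Proof.
move=> [c0 Ac0] Atot; pose X := \bigcup_(c in A) coding_dom c.
have common s : seqs_on X s -> exists c, A c /\ seqs_on (coding_dom c) s.
  elim: s => [|x s IHs] sX; first by exists c0.
  have [|c [Ac sc]] := IHs; first by move=> y ys; apply: sX; rewrite inE ys orbT.
  have [d Ad xd] := sX x (mem_head _ _).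
  have [cd|dc] := Atot _ _ Ac Ad.
    by exists d; split=> // y; rewrite inE => /predU1P[->//|/sc /cd.1].
  by exists c; split=> // y; rewrite inE => /predU1P[->|/sc//]; exact: dc.1.
have common2 s t : seqs_on X s -> seqs_on X t ->
    exists c, [/\ A c, seqs_on (coding_dom c) s & seqs_on (coding_dom c) t].
  move=> sX tX; have [|c [Ac stc]] := common (s ++ t).
    by move=> x; rewrite mem_cat => /orP[/sX|/tX].
  by exists c; split=> // x xs; apply: stc; rewrite mem_cat xs ?orbT.
have agree c d s : A c -> A d -> seqs_on (coding_dom c) s ->
    seqs_on (coding_dom d) s -> coding c s = coding d s.
  by move=> Ac Ad sc sd; have [[_ ->]|[_ ->]] := Atot _ _ Ac Ad.
have ex_code s : exists y, forall c, A c -> seqs_on (coding_dom c) s ->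
    coding c s = y.
  have [sX|nsX] := pselect (seqs_on X s).
    have [c [Ac sc]] := common s sX.
    by exists (coding c s) => d Ad sd; exact: agree.
  (* No member of the chain codes such an [s], so this value is arbitrary. *)
  exists (coding c0 s) => c Ac sc; case: nsX.
  by apply: seqs_onS sc; exact: bigcup_sup.
have [f fE] := choice ex_code.
have f_in s : seqs_on X s -> X (f s).
  move=> /common[c [Ac sc]]; exists c => //.
  by rewrite -(fE s c Ac sc); exact: coding_in.
have f_inj s t : seqs_on X s -> seqs_on X t -> f s = f t -> s = t.
  move=> sX tX; have [c [Ac sc tc]] := common2 s t sX tX.
  by rewrite -(fE s c) // -(fE t c) //; exact: coding_inj.
exists (SeqCoding f_in f_inj) => c Ac; split=> /= [|s sc].
  exact: bigcup_sup.
exact: fE.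
Qed.

(* If h injects Y \ X into X, then a coding of the sequences on X yields one of
   the sequences on Y: replace x in X by the code of [:: x] and y in Y \ X by
   the code of [:: h y; h y]. *)
Lemma coding_extend (c : seq_coding) (Y : set T) (h : T -> T) :
  (forall y, Y y -> ~ coding_dom c y -> coding_dom c (h y)) ->
  (forall y z, Y y -> Y z -> ~ coding_dom c y -> ~ coding_dom c z ->
     h y = h z -> y = z) ->
  exists j : seq T -> seq T,
    (forall s, seqs_on Y s -> seqs_on (coding_dom c) (j s)) /\
    (forall s t, seqs_on Y s -> seqs_on Y t -> j s = j t -> s = t).
Proof.
move=> hX h_inj; pose k x := if `[< coding_dom c x >] then [:: x] else [:: h x; h x].
have kX x : Y x -> seqs_on (coding_dom c) (k x).
  move=> Yx y; rewrite /k; case: asboolP => xc; rewrite !inE.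
    by move=> /eqP->.
  by rewrite orbb => /eqP->; exact: hX.
have k_inj x y : Y x -> Y y -> coding c (k x) = coding c (k y) -> x = y.
  move=> Yx Yy /(coding_inj (kX _ Yx) (kX _ Yy)); rewrite /k.
  case: asboolP => xc; case: asboolP => yc //; first by case.
  by case=> ehxy; exact: h_inj.
exists (map (coding c \o k)); split=> [s sY _ /mapP[x xs ->]|].
  by apply: coding_in; apply: kX; exact: sY.
elim=> [|x s IHs] [|y t] //= sY tY [exy est].
congr (_ :: _); first by apply: k_inj exy; [apply: sY|apply: tY]; exact: mem_head.
by apply: IHs est => z zs; [apply: sY|apply: tY]; rewrite inE zs orbT.
Qed.

(** Let [X] be the domain of a maximal coding. If the complement of [X] injects into [X], the coding
    transfers to all of [T]. Otherwise [X] injects into its complement, and adjoining the copy of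
    [X] found there contradicts maximality. *)
Lemma infinite_seq_inj :
  infinite_set [set: T] -> exists f : seq T -> T, injective f.
Proof.
move=> /infiniteP/card_leTP[i i_inj].
have [r ri] : exists r, cancel i r.
  have /choice[r rP] : forall x, exists n, forall m, i m = x -> m = n.
    move=> x; have [[n <-]|nx] := pselect (exists n, i n = x).
      by exists n => m /i_inj.
    by exists 0%N => m ex; case: nx; exists m.
  by exists r => n; rewrite -(rP (i n) n).
(* The starting coding lives on a copy of the naturals in [T], where [pickle] encodes finite
   sequences of naturals. *)
have c0 : seq_coding.
  apply: (@SeqCoding (range i) (fun s => i (choice.pickle (map r s))))
    => [s _|s t si ti].
    by exists (choice.pickle (map r s)).
  move=> /i_inj/(pcan_inj choice.pickleK) est.
  have irs u : seqs_on (range i) u -> map (i \o r) u = u.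
    move=> ui; rewrite -[RHS]map_id.
    by apply/eq_in_map => x /ui[n _ <-] /=; rewrite ri.
  by rewrite -(irs s si) -(irs t ti) (map_comp i r s) (map_comp i r t) est.
have [c cmax] : exists c, premaximal coding_le c.
  have [|||c cmax] := @ZL_preorder _ c0 (fun c d => `[< coding_le c d >]).
  - by move=> c; apply/asboolP; split.
  - move=> d c e /asboolP cd /asboolP de; apply/asboolP.
    exact: coding_le_trans cd de.
  - move=> A Atot; have [A0|nA] := pselect (A !=set0); last first.
      by exists c0 => d Ad; case: nA; exists d.
    have [|d dA] := coding_chain A0.
      by move=> c d Ac Ad; have [/asboolP|/asboolP] := Atot _ _ Ac Ad; [left|right].
    by exists d => c /dA /asboolP.
  - by exists c => d /asboolP/cmax/asboolP.
pose X := coding_dom c.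
have [[h h_inj]|[g g_inj]] := inj_total {x | ~ X x} {x | X x}.
  pose h' x := if pselect (~ X x) is left nXx then sval (h (exist _ x nXx)) else x.
  have [| |j [jX j_inj]] := @coding_extend c setT h'.
  - by move=> y _ nXy; rewrite /h'; case: pselect => // ?; exact: svalP.
  - move=> y z _ _ nXy nXz; rewrite /h'; case: pselect => // y'; case: pselect => // z'.
    by move=> /sval_inj/h_inj[].
  exists (coding c \o j) => s t /= /coding_inj est.
  by apply: j_inj => //; apply: est; exact: jX.
pose g' x := if pselect (X x) is left Xx then sval (g (exist _ x Xx)) else x.
have g'X x : X x -> ~ X (g' x).
  by move=> Xx; rewrite /g'; case: pselect => // p; exact: (svalP (g (exist _ x p))).
have g'_inj x y : X x -> X y -> g' x = g' y -> x = y.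
  move=> Xx Xy; rewrite /g'; case: pselect => // x'; case: pselect => // y'.
  by move=> /sval_inj/g_inj[].
have [h hg] : exists h : T -> T, forall x, X x -> h (g' x) = x.
  have /choice[h hP] : forall y, exists z, forall x, X x -> g' x = y -> x = z.
    move=> y; have [[x [Xx <-]]|ny] := pselect (exists x, X x /\ g' x = y).
      by exists x => z Xz egzx; exact: g'_inj.
    by exists y => x Xx ex; case: ny; exists x.
  by exists h => x Xx; rewrite -(hP (g' x) x).
(* [Y] doubles [X]; on the new half, [h] is the inverse of [g']. *)
pose Y := X `|` g' @` X.
have nX y : Y y -> ~ X y -> exists2 x, X x & y = g' x.
  by move=> [//|[x Xx <-]] _; exists x.
have [| |j [jX j_inj]] := @coding_extend c Y h.
- by move=> y Yy /(nX y Yy)[x Xx ->]; rewrite hg.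
- by move=> y z Yy Yz /(nX y Yy)[x Xx ->] /(nX z Yz)[w Xw ->]; rewrite !hg // => ->.
(* Old sequences keep their codes in [X], so [f] extends [coding c]; new ones get codes in the copy
   of [X], so the two kinds cannot collide. *)
pose f s := if `[< seqs_on X s >] then coding c s else g' (coding c (j s)).
have f_in s : seqs_on Y s -> Y (f s).
  move=> sY; rewrite /f; case: asboolP => sX; first by left; exact: coding_in.
  by right; apply: imageP; apply: coding_in; exact: jX.
have f_inj s t : seqs_on Y s -> seqs_on Y t -> f s = f t -> s = t.
  move=> sY tY; rewrite /f; case: asboolP => sX; case: asboolP => tX est.
  - exact: coding_inj est.
  - case: (g'X (coding c (j t))); last by rewrite -est; exact: coding_in.
    by apply: coding_in; exact: jX.
  - case: (g'X (coding c (j s))); last by rewrite est; exact: coding_in.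
    by apply: coding_in; exact: jX.
  apply: j_inj => //; apply: (@coding_inj c); [exact: jX|exact: jX|].
  by apply: g'_inj est; apply: coding_in; exact: jX.
(* Maximality puts [Y] inside [X], yet [g'] sends the code of the empty sequence out of [X] and into
   [Y]. *)
have [|YX _] := cmax (SeqCoding f_in f_inj).
  split=> [x|s sX] /=; first by left.
  by rewrite /f; case: asboolP.
have X0 : X (coding c [::]) by exact: coding_in.
by case: (g'X _ X0); apply: YX; right; exact: imageP.
Qed.

End SeqCardinal.

Lemma finite_ord_inj (T : Type) : finite_set [set: T] ->
  exists n (f : T -> 'I_n), injective f.
Proof.
move=> [n /card_eqPle[Tn _]]; exists n; apply/card_leTP.
by rewrite -(card_le_eqr card_II).
Qed.

(** * Closure of small types under finite products and tensor products *)

Section Small.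
Variables (K : Type) (K_infinite : infinite_set [set: K]).

Lemma card_lt_inj (T U : Type) (f : T -> U) :
  injective f -> card_lt U K -> card_lt T K.
Proof.
move=> f_inj [UK nKU].
have TU : ([set: T] #<= [set: U])%card by apply/card_leTP; exists f.
by split=> [|KT]; [exact: card_le_trans UK|apply/nKU/(card_le_trans KT)].
Qed.

Lemma card_lt_surj (T U : Type) (f : T -> U) :
  (forall y, exists x, f x = y) -> card_lt T K -> card_lt U K.
Proof. by move=> /surj_inj[g]; exact: card_lt_inj. Qed.

Lemma card_lt_finite (T : Type) : finite_set [set: T] -> card_lt T K.
Proof.
move=> finT; have nKT : ~ ([set: K] #<= [set: T])%card.
  by move=> KT; apply: K_infinite; exact: card_le_finite KT finT.
split=> //; have [|] := inj_total T K; first by move/card_leTP.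
by move/card_leTP.
Qed.

Lemma card_lt_infinite_seq (T : choiceType) :
  infinite_set [set: T] -> card_lt T K -> card_lt (seq T) K.
Proof. by move=> /infinite_seq_inj[f]; exact: card_lt_inj. Qed.

Lemma card_lt_ffun n (T : choiceType) :
  card_lt T K -> card_lt {ffun 'I_n -> T} K.
Proof.
move=> ltTK; have [finT|infT] := pselect (finite_set [set: T]); last first.
  apply: card_lt_inj (card_lt_infinite_seq infT ltTK).
  by move=> u v /val_inj/(can_inj fgraphK); exact.
have [m [e e_inj]] := finite_ord_inj finT.
pose F (u : {ffun 'I_n -> T}) := [ffun i => e (u i)].
apply: (@card_lt_inj _ {ffun 'I_n -> 'I_m} F).
  move=> u v /ffunP euv; apply/ffunP => i.
  by apply: e_inj; have := euv i; rewrite !ffunE.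
exact/card_lt_finite/finite_finset.
Qed.

(** Types are comparable by [inj_total], so one of finitely many dominates the others; [unit] serves
    the empty family. *)
Lemma card_lt_common n (S : 'I_n -> choiceType) : (forall i, card_lt (S i) K) ->
  exists T : choiceType, card_lt T K /\ forall i, exists f : S i -> T, injective f.
Proof.
elim: n S => [|n IHn] S ltSK.
  exists unit; split=> [|[]//]; exact/card_lt_finite/finite_finset.
have [T [ltTK ST]] := IHn (fun i => S (lift ord0 i)) (fun i => ltSK _).
have [[f f_inj]|[f f_inj]] := inj_total T (S ord0).
  exists (S ord0); split=> // i; have [j ->|->] := unliftP ord0 i; last by exists id.
  by have [g g_inj] := ST j; exists (f \o g); exact: inj_comp.
exists T; split=> // i; have [j ->|->] := unliftP ord0 i; first exact: ST.
by exists f.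
Qed.

Lemma card_lt_prodr n (S : 'I_n -> smallRing K) : card_lt (prodr S) K.
Proof.
have [T [ltTK STl]] := card_lt_common (fun i => smallRingP (S i)).
pose f i := sval (cid (STl i)).
have f_inj i : injective (f i) := svalP (cid (STl i)).
pose F (u : prodr S) := [ffun i => f i (prodr_proj i u)].
apply: (@card_lt_inj _ _ F _ (card_lt_ffun n ltTK)).
move=> u v /ffunP euv; apply: prodrP => i.
by apply: f_inj; have := euv i; rewrite !ffunE.
Qed.

Section SmallTensor.
Variables (R : comPzRingType) (M N : lmodType R).

(** If [N] is infinite, formal sums are finite sequences over an infinite small type. If [N] is
    finite, collecting terms with the same right factor writes every tensor with one coefficient in
    [M] per element of [N]. *)
Lemma card_lt_tens : card_lt M K -> card_lt N K -> card_lt (tens M N) K.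
Proof.
move=> ltMK ltNK; have [finN|infN] := pselect (finite_set [set: N]).
  have [n [e e_inj]] := finite_ord_inj finN.
  (* [r] is a left inverse of the numbering [e], with default value 0 off its image. *)
  have /choice[r re] : forall i, exists x, forall y, e y = i -> y = x.
    move=> i; have [[y <-]|ni] := pselect (exists y, e y = i).
      by exists y => z /e_inj.
    by exists 0 => z ez; case: ni; exists z.
  pose F (u : {ffun 'I_n -> M}) := \sum_i pure (u i) (r i).
  apply: (@card_lt_surj _ _ F _ (card_lt_ffun n ltMK)); rewrite /F.
  elim/tens_ind => [|m x|x y [u <-] [v <-]].
  - by exists 0; apply: big1 => i _; rewrite ffunE pure0l.
  - exists [ffun i => if i == e x then m else 0].
    rewrite (bigD1 (e x)) //= ffunE eqxx -(re (e x) x) // big1 ?addr0 // => i.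
    by rewrite ffunE => /negPf->; rewrite pure0l.
  exists (u + v); rewrite -big_split /=; apply: eq_bigr => i _.
  by rewrite ffunE pureDl.
(* [T] is the larger of [M] and [N]; a pair in [M * N] then becomes a two-letter word over [T], and
   a formal sum a sequence of such words. *)
have [T [ltTK infT [f f_inj] [g g_inj]]] : exists T : choiceType,
    [/\ card_lt T K, infinite_set [set: T],
        exists f : M -> T, injective f & exists g : N -> T, injective g].
  have [[f f_inj]|[f f_inj]] := inj_total M N.
    by exists N; split=> //; [exists f|exists id].
  exists M; split=> //; [|by exists id|by exists f].
  move=> finM; apply: infN; apply: card_le_finite finM.
  by apply/card_leTP; exists f.
have infs : infinite_set [set: seq T].
  move=> fins; apply: infT; apply: card_le_finite fins.
  by apply/card_leTP; exists (fun x => [:: x]) => x y [].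
apply: (@card_lt_surj _ _ (fun s => \pi_(tens M N)%qT s)).
  by move=> x; have [s ->] := tens_surj x; exists s.
apply: card_lt_inj (card_lt_infinite_seq infs (card_lt_infinite_seq infT ltTK)).
apply: (@inj_map _ _ (fun p : M * N => [:: f p.1; g p.2])).
by move=> [m x] [m' x'] /= [/f_inj -> /g_inj ->].
Qed.

End SmallTensor.
End Small.

(** * Base change of faithful flatness *)

(* [functions] defines another [restrict]. *)
Local Notation restrict := Defs.restrict.

(** Exactness involves only the image of [u] and the zero fibre of [v]; additivity of [e3] makes
    zero correspond to zero. *)
Lemma exact_at_bij (N1 N2 N3 P1 P2 P3 : zmodType)
    (u : N1 -> N2) (v : N2 -> N3) (u' : P1 -> P2) (v' : P2 -> P3)
    (e1 : N1 -> P1) (e2 : N2 -> P2) (e3 : {additive N3 -> P3}) :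
    bijective e1 -> bijective e2 -> bijective e3 ->
    (forall x, e2 (u x) = u' (e1 x)) -> (forall x, e3 (v x) = v' (e2 x)) ->
  exact_at u v <-> exact_at u' v'.
Proof.
move=> [d1 e1K d1K] [d2 e2K d2K] [d3 e3K d3K] eu ev.
have e3_0 x : e3 x = 0 <-> x = 0.
  split=> [|->]; last exact: raddf0.
  by rewrite -[X in _ = X -> _](raddf0 e3) => /(can_inj e3K).
split=> uv y.
  rewrite -(d2K y) -ev e3_0 uv; split=> [[x <-]|[x]].
    by exists (e1 x); rewrite eu.
  by rewrite -(d1K x) -eu => /(can_inj e2K) <-; exists (d1 x).
rewrite -e3_0 ev uv; split=> [[x]|[x <-]].
  by rewrite -(d1K x) -eu => /(can_inj e2K) <-; exists (d1 x).
by exists (e1 x); rewrite eu.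
Qed.

Lemma tens_additive_eq (R : comPzRingType) (M N : lmodType R) (Z : nmodType)
    (g h : tens M N -> Z) : nmod_morphism g -> nmod_morphism h ->
  (forall m n, g (pure m n) = h (pure m n)) -> g =1 h.
Proof.
move=> [g0 gD] [h0 hD] gh; elim/tens_ind => [|//|x y ex ey]; first by rewrite g0.
by rewrite gD hD ex ey.
Qed.

Lemma tens_elim_nmod (R : comPzRingType) (M N : lmodType R) (Z : nmodType)
    (phi : M -> N -> Z) : balanced phi -> nmod_morphism (tens_elim phi).
Proof. by move=> phiB; split; [exact: tens_elim0|exact: tens_elimD]. Qed.

Section TensMapl.
Variables (R : comPzRingType) (M M' N : lmodType R) (e : {linear M -> M'}).

Lemma balanced_mapl : balanced (fun m (n : N) => pure (e m) n).
Proof.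
split=> [n|m m' n|m n n'|a m n]; first by rewrite linear0 pure0l.
- by rewrite linearD pureDl.
- exact: pureDr.
by rewrite linearZ pureZlr.
Qed.

Definition tens_mapl : tens M N -> tens M' N :=
  tens_elim (fun m n => pure (e m) n).

Lemma tens_mapl_pure m n : tens_mapl (pure m n) = pure (e m) n.
Proof. exact: (tens_elim_pure balanced_mapl). Qed.

Lemma tens_mapl_nmod : nmod_morphism tens_mapl.
Proof. exact: tens_elim_nmod balanced_mapl. Qed.

HB.instance Definition _ :=
  GRing.isNmodMorphism.Build (tens M N) (tens M' N) tens_mapl tens_mapl_nmod.

End TensMapl.

Arguments tens_mapl {R M M'} N e.

Lemma tens_mapl_can (R : comPzRingType) (M M' N : lmodType R)
    (e : {linear M -> M'}) (d : {linear M' -> M}) :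
  cancel e d -> cancel (tens_mapl N e) (tens_mapl N d).
Proof.
move=> eK.
apply: (@tens_additive_eq _ _ _ _ (tens_mapl N d \o tens_mapl N e) idfun) => [||m n].
- by split=> [|x y]; rewrite /= ?raddf0 ?raddfD.
- by [].
by rewrite /= !tens_mapl_pure eK.
Qed.

Lemma tens_mapl_mapr (R : comPzRingType) (M M' N N' : lmodType R)
    (e : {linear M -> M'}) (u : {linear N -> N'}) (x : tens M N) :
  tens_mapl N' e (tens_mapr M u x) = tens_mapr M' u (tens_mapl N e x).
Proof.
apply: (@tens_additive_eq _ _ _ _ (tens_mapl N' e \o tens_mapr M u)
  (tens_mapr M' u \o tens_mapl N e)) x => [||m n].
- by split=> [|x y]; rewrite /= ?raddf0 ?raddfD.
- by split=> [|x y]; rewrite /= ?raddf0 ?raddfD.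
by rewrite /= tens_mapl_pure !tens_mapr_pure tens_mapl_pure.
Qed.

Lemma faithfully_flat_module_iso (R : comPzRingType) (M M' : lmodType R)
    (e : {linear M -> M'}) (d : {linear M' -> M}) :
  cancel e d -> cancel d e -> faithfully_flat_module M -> faithfully_flat_module M'.
Proof.
move=> eK dK ffM N1 N2 N3 u v; rewrite ffM.
have bij N : bijective (tens_mapl N e).
  by exists (tens_mapl N d); apply: tens_mapl_can.
exact: exact_at_bij (bij N1) (bij N2) (bij N3) (tens_mapl_mapr _ _)
  (tens_mapl_mapr _ _).
Qed.

(** * Restriction of scalars for modules *)

Section RestrictModule.
Variables (A R : comPzRingType) (y : {rmorphism A -> R}).

(** The unnamed argument keeps [y] in the type, so that the A-module structure can be found from it
    alongside the R-module structure of [N]. *)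
Definition restrict_mod (N : lmodType R) of {rmorphism A -> R} : Type := N.

Section Structure.
Variable N : lmodType R.
Local Notation N' := (restrict_mod N y).

HB.instance Definition _ := GRing.Zmodule.on N'.

Definition restrict_mod_scale (a : A) (x : N') : N' := y a *: (x : N).

Lemma restrict_mod_scaleA a b x :
  restrict_mod_scale a (restrict_mod_scale b x) = restrict_mod_scale (a * b) x.
Proof. by rewrite /restrict_mod_scale rmorphM scalerA. Qed.

Lemma restrict_mod_scale1 : left_id 1 restrict_mod_scale.
Proof. by move=> x; rewrite /restrict_mod_scale rmorph1 scale1r. Qed.

Lemma restrict_mod_scaleDr : right_distributive restrict_mod_scale +%R.
Proof. by move=> a; exact: scalerDr. Qed.

Lemma restrict_mod_scaleDl x : {morph restrict_mod_scale^~ x : a b / a + b}.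
Proof. by move=> a b; rewrite /restrict_mod_scale rmorphD; exact: scalerDl. Qed.

HB.instance Definition _ := GRing.Zmodule_isLmodule.Build A N'
  restrict_mod_scaleA restrict_mod_scale1 restrict_mod_scaleDr
  restrict_mod_scaleDl.
End Structure.

Section Map.
Variables (N1 N2 : lmodType R) (u : {linear N1 -> N2}).

Definition restrict_map_fun : restrict_mod N1 y -> restrict_mod N2 y := u.

Lemma restrict_map_linear : linear restrict_map_fun.
Proof. by move=> a m n; exact: (linearP u (y a)). Qed.

HB.instance Definition _ :=
  GRing.isLinear.Build A _ _ _ restrict_map_fun restrict_map_linear.

Definition restrict_map : {linear restrict_mod N1 y -> restrict_mod N2 y} :=
  [the {linear restrict_mod N1 y -> restrict_mod N2 y} of restrict_map_fun].
End Map.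

End RestrictModule.

Arguments restrict_map {A R} y {N1 N2} u.

(** * The natural isomorphism between the R-tensor of [tensr y h] with [N] and the A-tensor of C
    with [N] *)

Section BaseChange.
Variables (A R C : comPzRingType).
Variables (y : {rmorphism A -> R}) (h : {rmorphism A -> C}).

Local Notation RC := (restrict (tinl y h)).

Section Module.
Variable N : lmodType R.
Local Notation CN := (tens (restrict h) (restrict_mod N y)).

(** The inner of two nested eliminations: the left factor in [base_change] is itself a tensor
    product, treated here for fixed [n]. *)
Definition act_pure (n : N) : tensr y h -> CN :=
  @tensr_elim A R C y h CN
    (fun r c => pure (c : restrict h) (r *: n : restrict_mod N y)).

Lemma balanced_act_pure n :
  tensr_balanced y h
    (fun r (c : C) => pure (c : restrict h) (r *: n : restrict_mod N y)).
Proof.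
split=> [c|r r' c|r c c'|a r c].
(* Zero on the right is written as 0 times 0 and the scalar is moved to the left factor. *)
- by rewrite scale0r -(scale0r (0 : restrict_mod N y)) -pureZlr scale0r pure0l.
- by rewrite scalerDl; exact: pureDr.
- exact: pureDl.
by rewrite pureZlr -[a *: r]/(y a * r) -scalerA.
Qed.

Lemma act_pureE n r c : act_pure n (tpure y h r c) =
  pure (c : restrict h) (r *: n : restrict_mod N y).
Proof. exact: (tens_elim_pure (balanced_act_pure n)). Qed.

Lemma act_pure_nmod n : nmod_morphism (act_pure n).
Proof. exact: tens_elim_nmod (balanced_act_pure n). Qed.

Lemma balanced_base_change : @balanced R RC N CN (fun (t : RC) (n : N) => act_pure n t).
Proof.
split=> [n|t t' n|t n n'|r t n].
- by case: (act_pure_nmod n).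
- by case: (act_pure_nmod n).
- elim/tensr_ind: t => [|r c|t t' et et'].
  + by rewrite !(act_pure_nmod _).1 addr0.
  + by rewrite !act_pureE scalerDr; exact: pureDr.
  by rewrite !(act_pure_nmod _).2 et et' addrACA.
(* The R-action through [tinl] is multiplication by [r (x) 1]. *)
have -> : r *: t = tpure y h r 1 * t by [].
elim/tensr_ind: t => [|r' c|t t' et et'].
- by rewrite mulr0 !(act_pure_nmod _).1.
- by rewrite tpureM mul1r !act_pureE scalerA mulrC.
by rewrite mulrDr !(act_pure_nmod _).2 et et'.
Qed.

(* (r (x) c) (x) n |-> c (x) r n *)
Definition base_change : tens RC N -> CN :=
  @tens_elim R RC N CN (fun t n => act_pure n t).

Lemma base_change_nmod : nmod_morphism base_change.
Proof. exact: tens_elim_nmod balanced_base_change. Qed.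

HB.instance Definition _ :=
  GRing.isNmodMorphism.Build (tens RC N) CN base_change base_change_nmod.

Lemma base_change_pure r c n :
  base_change (pure (tpure y h r c : RC) n) =
  pure (c : restrict h) (r *: n : restrict_mod N y).
Proof. by rewrite [LHS](tens_elim_pure balanced_base_change) act_pureE. Qed.

Lemma balanced_base_change_inv :
  @balanced A (restrict h) (restrict_mod N y) (tens RC N)
  (fun c n =>
  pure (tpure y h 1 c : RC) (n : N)).
Proof.
split=> [n|c c' n|c n n'|a c n].
- by rewrite tpure0r pure0l.
- by rewrite tpureDr; exact: pureDl.
- exact: pureDr.
rewrite -[a *: n]/(y a *: (n : N)) -pureZlr; congr (pure _ _).
rewrite -[RHS]/(tpure y h (y a) 1 * tpure y h 1 c) tpureM mul1r.
by rewrite -[a *: c]/(h a * c) -tpureZlr.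
Qed.

(* c (x) n |-> (1 (x) c) (x) n *)
Definition base_change_inv : CN -> tens RC N :=
  @tens_elim A (restrict h) (restrict_mod N y) (tens RC N)
    (fun c n => pure (tpure y h 1 c : RC) (n : N)).

Lemma base_change_inv_nmod : nmod_morphism base_change_inv.
Proof. exact: tens_elim_nmod balanced_base_change_inv. Qed.

Lemma base_change_inv_pure c n :
  base_change_inv (pure c n) = pure (tpure y h 1 c : RC) (n : N).
Proof. exact: (tens_elim_pure balanced_base_change_inv). Qed.

Lemma base_changeK : cancel base_change base_change_inv.
Proof.
elim/tens_ind => [|t n|t t' et et'].
- by rewrite raddf0; case: base_change_inv_nmod.
- elim/tensr_ind: t => [|r c|t t' et et'].
  + by rewrite pure0l raddf0; case: base_change_inv_nmod.
  (* The scalar [r], pushed onto [n] by [base_change], moves back across the tensor over R. *)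
  + rewrite base_change_pure base_change_inv_pure -pureZlr; congr (pure _ _).
    rewrite -[LHS]/(tpure y h r 1 * tpure y h 1 c) tpureM mul1r mulr1 //.
  by rewrite pureDl raddfD base_change_inv_nmod.2 et et'.
by rewrite raddfD base_change_inv_nmod.2 et et'.
Qed.

Lemma base_change_invK : cancel base_change_inv base_change.
Proof.
elim/tens_ind => [|c n|t t' et et'].
- by rewrite base_change_inv_nmod.1 raddf0.
- by rewrite base_change_inv_pure base_change_pure scale1r.
by rewrite base_change_inv_nmod.2 base_change_nmod.2 et et'.
Qed.

End Module.

Lemma base_change_mapr (N N' : lmodType R) (u : {linear N -> N'}) t :
  base_change (tens_mapr RC u t) =
  tens_mapr (restrict h) (restrict_map y u) (base_change t).
Proof.
elim/tens_ind: t => [|t n|t t' et et']; first by rewrite !raddf0.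
  rewrite tens_mapr_pure; elim/tensr_ind: t => [|r c|t t' et et'].
  - by rewrite !pure0l !raddf0.
  - rewrite !base_change_pure tens_mapr_pure; congr (pure _ _).
    by rewrite -linearZ.
  by rewrite !pureDl !(base_change_nmod _).2 linearD et et'.
by rewrite linearD !(base_change_nmod _).2 linearD et et'.
Qed.

(** By the natural isomorphism, testing the base change on R-modules amounts to testing [h] on their
    restrictions to A, and restriction leaves the underlying maps, hence exactness, unchanged. *)
Lemma faithfully_flat_base_change : faithfully_flat h -> faithfully_flat (tinl y h).
Proof.
move=> ffh N1 N2 N3 u v.
have bij N : bijective (@base_change N) by exists (@base_change_inv N);
  [exact: base_changeK|exact: base_change_invK].
rewrite (exact_at_bij (bij N1) (bij N2) (bij N3) (base_change_mapr u)
  (base_change_mapr v)).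
exact: (ffh _ _ _ (restrict_map y u) (restrict_map y v)).
Qed.

End BaseChange.

Lemma faithfully_flat_flat (R S : comPzRingType) (h : {rmorphism R -> S}) :
  faithfully_flat h -> flat h.
Proof. by move=> ffh N1 N2 N3 u v /ffh. Qed.

(** Lets a single faithfully flat map serve as a flat cover: the product of a one-member family is
    isomorphic to that member. *)
Lemma faithfully_flat_prodr1 (R S : comPzRingType) (h : {rmorphism R -> S}) :
  faithfully_flat h -> faithfully_flat (prodr_tuple (fun _ : 'I_1 => h)).
Proof.
pose P := restrict (prodr_tuple (fun _ : 'I_1 => h)).
pose e (s : restrict h) : P := prodr_mk (fun _ : 'I_1 => s : S).
pose d (p : P) : restrict h := prodr_proj ord0 (p : prodr (fun _ : 'I_1 => S)).
have e_lin : linear e.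
  by move=> a s t; apply: prodrP => i; rewrite !prodr_mkE.
have d_lin : linear d.
  move=> a p q; rewrite /d [LHS]prodr_mkE; congr (_ + _).
  by rewrite [LHS]prodr_mkE prodr_mkE.
pose eL := HB.pack_for {linear restrict h -> P} e
  (GRing.isLinear.Build R _ _ _ e e_lin).
pose dL := HB.pack_for {linear P -> restrict h} d
  (GRing.isLinear.Build R _ _ _ d d_lin).
apply: (@faithfully_flat_module_iso _ _ _ eL dL) => [s|p].
  exact: (prodr_mkE (fun _ : 'I_1 => s : S) ord0).
by apply: prodrP => i; rewrite prodr_mkE (ord1 i).
Qed.

(** * Maps of Hopf algebroids *)

Lemma rmorph_eq (R S : pzSemiRingType) (u v : {rmorphism R -> S}) :
  u = v -> u =1 v.
Proof. by move=> ->. Qed.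

Lemma tinl_tinr (A B C : comPzRingType) (f : {rmorphism A -> B})
    (g : {rmorphism A -> C}) : rcomp (tinl f g) f = rcomp (tinr f g) g.
Proof.
by apply: rmorphP => a; have := tpureZlr f g a 1 1; rewrite !mulr1 => ea; exact: ea.
Qed.

Section HopfMapEquivalence.
Variables (K : Type) (K_infinite : infinite_set [set: K]).
Variables (X Y : hopf_algebroid K) (f : hopf_map X Y).

Local Notation BGB_pure b c b' := (tpure (f0_tens_etaR f) (f0 f)
  (tpure (f0 f) (etaL X) b c) b').

Lemma BGB_eq (R : comPzRingType) (u v : {rmorphism BGB f -> R}) :
  (forall b c b', u (BGB_pure b c b') = v (BGB_pure b c b')) -> u = v.
Proof.
move=> uv; apply: tensr_eq => t b'; elim/tensr_ind: t => [|b c|t t' et et'].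
- by rewrite tpure0l !rmorph0.
- exact: uv.
by rewrite tpureDl !rmorphD et et'.
Qed.

Lemma card_lt_BGB : card_lt (BGB f) K.
Proof.
apply: card_lt_tens => //; last exact: smallRingP.
by apply: card_lt_tens => //; exact: smallRingP.
Qed.

Lemma etaL_f1_etaR_etaL b : etaL_f1_etaR f (BGB_pure b 1 1) = etaL Y b.
Proof. by rewrite etaL_f1_etaRE !rmorph1 !mulr1. Qed.

Lemma etaL_f1_etaR_f1 c : etaL_f1_etaR f (BGB_pure 1 c 1) = f1 f c.
Proof. by rewrite etaL_f1_etaRE !rmorph1 mulr1 mul1r. Qed.

Lemma etaL_f1_etaR_etaR b : etaL_f1_etaR f (BGB_pure 1 1 b) = etaR Y b.
Proof. by rewrite etaL_f1_etaRE !rmorph1 !mul1r. Qed.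

(* Full faithfulness at R says that B (x) Gamma (x) B and Sigma have the same
   points over R; the two rings being small, Yoneda applies. *)
Lemma fully_faithful_bijective :
  (forall R : smallRing K, full (spec_pullback f R) /\ faithful (spec_pullback f R)) ->
  bijective (etaL_f1_etaR f).
Proof.
move=> ff; pose R := SmallRing card_lt_BGB.
(* The tautological point of [BGB f] over itself: [x] and [y] are the outer inclusions, and the
   middle one, [b], is an arrow between their images. The lift [a] of [b] given by fullness is the
   inverse sought. *)
pose l : {rmorphism BG f -> BGB f} := tinl (f0_tens_etaR f) (f0 f).
pose x : {rmorphism hA Y -> R} := rcomp l (tinl (f0 f) (etaL X)).
pose y : {rmorphism hA Y -> R} := tinr (f0_tens_etaR f) (f0 f).
pose b : {rmorphism hG X -> R} := rcomp l (tinr (f0 f) (etaL X)).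
have [||a [ax ay ab]] := (ff R).1 x y b.
- by rewrite /= /b /x -!rcompA tinl_tinr.
- by rewrite /= /b -rcompA; exact: tinl_tinr.
have aL u : a (etaL Y u) = x u by exact: rmorph_eq ax u.
have aR u : a (etaR Y u) = y u by exact: rmorph_eq ay u.
have a1 u : a (f1 f u) = b u by exact: rmorph_eq ab u.
exists a => [t|s].
  apply: (@rmorph_eq _ _ (rcomp a (etaL_f1_etaR f)) (rid _)).
  apply: BGB_eq => p c q.
  rewrite /= etaL_f1_etaRE !rmorphM aL aR a1 /x /y /b /=.
  by rewrite /tinl_fun /tinr_fun !tpureM !mulr1 !mul1r.
apply: (@rmorph_eq _ _ (rcomp (etaL_f1_etaR f) a) (rid _)).
(* Faithfulness over Sigma reduces equality with the identity to equal source, target and image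
   under [f^*]. *)
apply: (ff (hG Y)).2; apply: rmorphP => u /=.
- by rewrite aL [LHS]etaL_f1_etaR_etaL.
- by rewrite aR [LHS]etaL_f1_etaR_etaR.
by rewrite a1 [LHS]etaL_f1_etaR_f1.
Qed.

(** An arrow [b] between images of [x] and [y] glues with them to a map out of [BGB f], and the
    inverse isomorphism carries it to Sigma. Faithfulness holds because the images of [etaL], [f1]
    and [etaR] generate Sigma. *)
Lemma bijective_fully_faithful (R : smallRing K) : bijective (etaL_f1_etaR f) ->
  full (spec_pullback f R) /\ faithful (spec_pullback f R).
Proof.
move=> [psi psiK phiK]; split=> [x y b bx b_y|a a' aL aR a1].
  have bxE u : b (etaL X u) = x (f0 f u) by exact: rmorph_eq bx u.
  have byE u : b (etaR X u) = y (f0 f u) by exact: rmorph_eq b_y u.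
  have xb : rcomp x (f0 f) = rcomp b (etaL X) by [].
  have xby : rcomp (tensr_lift xb) (f0_tens_etaR f) = rcomp y (f0 f).
    by apply: rmorphP => u; rewrite /= tensr_lift_pure rmorph1 mul1r byE.
  have psi_nmod : nmod_morphism psi by exact: can2_nmod_morphism psiK phiK.
  have psi_monoid : monoid_morphism psi by exact: can2_monoid_morphism psiK phiK.
  pose psiR := HB.pack_for {rmorphism hG Y -> BGB f} psi
    (GRing.isNmodMorphism.Build _ _ psi psi_nmod)
    (GRing.isMonoidMorphism.Build _ _ psi psi_monoid).
  have liftE p c q : tensr_lift xby (BGB_pure p c q) = x p * b c * y q.
    by rewrite !tensr_liftE.
  exists (rcomp (tensr_lift xby) psiR); split; apply: rmorphP => u /=.
  - by rewrite -etaL_f1_etaR_etaL psiK [LHS]liftE !rmorph1 !mulr1.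
  - by rewrite -etaL_f1_etaR_etaR psiK [LHS]liftE !rmorph1 !mul1r.
  by rewrite -etaL_f1_etaR_f1 psiK [LHS]liftE !rmorph1 mulr1 mul1r.
have src u : a (etaL Y u) = a' (etaL Y u) by exact: rmorph_eq aL u.
have tgt u : a (etaR Y u) = a' (etaR Y u) by exact: rmorph_eq aR u.
have mor u : a (f1 f u) = a' (f1 f u) by exact: rmorph_eq a1 u.
apply: rmorphP => s; rewrite -[s]phiK.
apply: (@rmorph_eq _ _ (rcomp a (etaL_f1_etaR f)) (rcomp a' (etaL_f1_etaR f))).
by apply: BGB_eq => b c b'; rewrite /= etaL_f1_etaRE !rmorphM src tgt mor.
Qed.

(* Apply essential surjectivity to the universal point [id] of Spec A. *)
Lemma ess_surj_faithfully_flat :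
  (forall (R : smallRing K) (y : obj (spec X R)),
     sheaf_essential_image (spec_pullback f) y) ->
  exists (C : smallRing K) (g : {rmorphism BG f -> C}),
    faithfully_flat (rcomp g (f0_tens_etaR f)).
Proof.
move=> /(_ (hA X) (rid _))[n [S [h [[_ ffh] im]]]].
(* An arrow over [S i] from the image of a point of Spec B to [h i] is the same as a factorization
   of [h i] through [BG f]. *)
have {}im i : exists g : {rmorphism BG f -> S i}, rcomp g (f0_tens_etaR f) = h i.
  have [x [a [ax ay]]] := im i.
  have xa : rcomp x (f0 f) = rcomp a (etaL X) by [].
  exists (tensr_lift xa); apply: rmorphP => u.
  rewrite /= tensr_lift_pure rmorph1 mul1r.
  exact: rmorph_eq ay u.
(* C is the product of the covering rings, so the composite from A is the tuple of the cover,
   faithfully flat by definition. *)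
exists (SmallRing (card_lt_prodr K_infinite S)).
exists (prodr_tuple (fun i => sval (cid (im i)))).
rewrite (_ : rcomp _ _ = prodr_tuple h) //.
apply: rmorphP => u; apply: prodrP => i; rewrite !prodr_mkE.
exact: rmorph_eq (svalP (cid (im i))) u.
Qed.

(** Over R (x)_A C the two maps from A, through R and through C, agree. The second is the target of
    the arrow encoded by [g], whose source comes from Spec B. *)
Lemma faithfully_flat_ess_surj (C : smallRing K) (g : {rmorphism BG f -> C}) :
  faithfully_flat (rcomp g (f0_tens_etaR f)) ->
  forall (R : smallRing K) (y : obj (spec X R)),
    sheaf_essential_image (spec_pullback f) y.
Proof.
set k := rcomp g _ => ffk R y.
have small : card_lt (tensr y k) K by apply: card_lt_tens => //; exact: smallRingP.
exists 1%N, (fun _ => SmallRing small), (fun _ => tinl y k).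
have fft := faithfully_flat_base_change y ffk.
split; first by split=> [_|]; [exact: faithfully_flat_flat|exact: faithfully_flat_prodr1].
(* The object and the arrow are the restrictions of [g] to the two factors of [BG f], followed by
   the inclusion of C. *)
move=> _; exists (rcomp (tinr y k) (rcomp g (tinl (f0 f) (etaL X)))).
exists (rcomp (tinr y k) (rcomp g (tinr (f0 f) (etaL X)))); split=> /=.
  by rewrite -!rcompA tinl_tinr.
by rewrite tinl_tinr -!rcompA.
Qed.

End HopfMapEquivalence.

Theorem theorem4 (K : Type) (K_infinite : infinite_set [set: K])
    (X Y : hopf_algebroid K) (f : hopf_map X Y) :
  internal_equivalence (spec_pullback f) <->
  bijective (etaL_f1_etaR f) /\
  exists (C : smallRing K) (g : {rmorphism BG f -> C}),
    faithfully_flat (rcomp g (f0_tens_etaR f)).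
Proof.
split=> [[ff ess]|[bij [C [g ffg]]]].
  by split; [exact: fully_faithful_bijective|exact: ess_surj_faithfully_flat].
split=> [R|]; first exact: bijective_fully_faithful.
exact: faithfully_flat_ess_surj ffg.
Qed.
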